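(* Let $\Bbbk$ be a field of positive characteristic $p>2$, let $n\ge 1$ be an integer, and let $X$ be an $n\times n$ matrix of indeterminates which is either generic, symmetric, or Hankel. Then the ring $\Bbbk[X]/\big(\operatorname{perm}(X)\big)$ is $F$-regular.
   Context: For a matrix $X$ of indeterminates, $\Bbbk[X]$ denotes the polynomial ring over $\Bbbk$ in the (distinct) indeterminates occurring as entries of $X$. An $n\times n$ matrix of indeterminates $X=(x_{ij})$ is: generic if its $n^2$ entries are distinct indeterminates; symmetric if $x_{ij}=x_{ji}$ for all $i,j$ and the entries $x_{ij}$ with $i\le j$ are distinct indeterminates; Hankel if $x_{ij}=z_{i+j-1}$ for all $i,j$, where $z_1,\dots,z_{2n-1}$ are distinct indeterminates. The permanent of an $n\times n$ matrix $X=(x_{ij})$ is $\operatorname{perm}(X)=\sum_{\sigma} x_{1,\sigma(1)}\cdots x_{n,\sigma(n)}$, where $\sigma$ ranges over all permutations of $\{1,\dots,n\}$. Let $R$ be a quotient of a standard graded polynomial ring over a field of characteristic $p>0$ by a homogeneous ideal. For an ideal $J=(m_1,\dots,m_k)$ of $R$ and $q=p^e$ with $e$ a positive integer, $J^{[q]}=(m_1^q,\dots,m_k^q)$. The tight closure $J^*$ of $J$ is the set of $r\in R$ for which there is a non-zerodivisor $c$ of $R$ such that $cr^q\in J^{[q]}$ for all sufficiently large $q=p^e$. The ring $R$ is called $F$-regular if $J=J^*$ for every ideal $J$ of $R$. *)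

(* Defs.v *)
From HB Require Import structures.
From mathcomp Require Import all_boot all_order all_fingroup all_algebra.
From mathcomp Require Import ring_quotient mpoly.
From mathcomp Require Import boolp classical_sets.

Set Implicit Arguments.
Unset Strict Implicit.
Unset Printing Implicit Defensive.

Import GRing.Theory.
Local Open Scope ring_scope.
Local Open Scope classical_set_scope.

Section TightClosure.
Variable R : comNzRingType.
Implicit Types (S T : set R) (p q : nat) (r x : R).

Definition ideal_gen S : set R :=
  [set x | exists2 s : seq (R * R), (forall am, am \in s -> S am.2) &
           x = \sum_(am <- s) am.1 * am.2].

(* In the three definitions below an ideal J is presented by a set S of       *)
(* generators, J = ideal_gen S. Taking for S the elements of a finite list    *)
(* (m_1, ..., m_k) gives J^[q] = (m_1^q, ..., m_k^q); S is allowed to be      *)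
(* infinite so that every ideal is covered (take S = J) without an appeal to  *)
(* noetherianity. By frobenius_power_ideal below, J^[q] depends on J only.    *)
Definition frobenius_power S q : set R := ideal_gen [set m ^+ q | m in S].

Definition tight_closure p S : set R :=
  [set r | exists2 c : R, GRing.lreg c &
           exists e0 : nat, forall e : nat, (e0 <= e)%N ->
             frobenius_power S (p ^ e) (c * r ^+ (p ^ e))].

Definition F_regular p : Prop :=
  forall S : set R, tight_closure p S = ideal_gen S.

Lemma ideal_gen_sub S x : S x -> ideal_gen S x.
Proof.
move=> Sx; exists [:: (1, x)]; last by rewrite big_seq1 mul1r.
by move=> am; rewrite inE => /eqP ->.
Qed.

Lemma ideal_gen0 S : ideal_gen S 0.
Proof. by exists [::]; rewrite ?big_nil. Qed.

Lemma ideal_genD S x y : ideal_gen S x -> ideal_gen S y -> ideal_gen S (x + y).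
Proof.
move=> [s Ss ->] [t St ->]; exists (s ++ t); last by rewrite big_cat.
by move=> am; rewrite mem_cat => /orP[/Ss|/St].
Qed.

Lemma ideal_genM S a x : ideal_gen S x -> ideal_gen S (a * x).
Proof.
move=> [s Ss ->]; exists [seq (a * am.1, am.2) | am <- s].
  by move=> am /mapP[bm /Ss Sbm ->].
by rewrite big_map mulr_sumr; apply: eq_bigr => am _; rewrite /= mulrA.
Qed.

Lemma ideal_gen_min S T : S `<=` ideal_gen T -> ideal_gen S `<=` ideal_gen T.
Proof.
move=> ST x [s Ss ->]; rewrite big_seq.
apply: big_ind => [|y z|am /Ss/ST]; first exact: ideal_gen0.
  exact: ideal_genD.
exact: ideal_genM.
Qed.

Lemma frobenius_power_ideal p e S T : p \in [pchar R] ->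
  ideal_gen S = ideal_gen T ->
  frobenius_power S (p ^ e) = frobenius_power T (p ^ e).
Proof.
move=> pR.
wlog suff sub : S T / ideal_gen S = ideal_gen T ->
    frobenius_power S (p ^ e) `<=` frobenius_power T (p ^ e).
  by move=> ST; apply/seteqP; split; apply: sub.
move=> ST; apply: ideal_gen_min => _ [m Sm <-].
have [s Ts ->] : ideal_gen T m by rewrite -ST; apply: ideal_gen_sub.
have pq : [pchar R].-nat (p ^ e)%N.
  by rewrite pnatX pnatE ?pR // (pcharf_prime pR).
suff -> : (\sum_(am <- s) am.1 * am.2) ^+ (p ^ e) =
          \sum_(am <- s) am.1 ^+ (p ^ e) * am.2 ^+ (p ^ e).
  rewrite big_seq; apply: big_ind => [|y z|am /Ts Tam].
  - exact: ideal_gen0.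
  - exact: ideal_genD.
  by apply/ideal_genM/ideal_gen_sub; exists am.2.
elim: s {Ts} => [|am s IHs].
  by rewrite !big_nil expr0n expn_eq0 -leqn0 leqNgt prime_gt0 ?(pcharf_prime pR).
by rewrite !big_cons exprDn_pchar // IHs exprMn.
Qed.

End TightClosure.

Section PrincipalQuotient.
Variables (R : comNzRingType) (f : R).

Definition principal_ideal : {pred R} := [pred x | `[< exists g, x = g * f >]].

Lemma principal_idealP x : reflect (exists g, x = g * f) (x \in principal_ideal).
Proof. exact: asboolP. Qed.

(* The library forms quotients by proper ideals only, so the ideal carries a  *)
(* proof of properness.                                                       *)
Definition proper_principal_ideal of 1 \notin principal_ideal : {pred R} :=
  principal_ideal.

Lemma principal_ideal_closed (f_proper : 1 \notin principal_ideal) :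
  idealr_closed (proper_principal_ideal f_proper).
Proof.
split=> //; first by apply/principal_idealP; exists 0; rewrite mul0r.
move=> a x y /principal_idealP[g ->] /principal_idealP[h ->].
by apply/principal_idealP; exists (a * g + h); rewrite mulrDl mulrA.
Qed.

HB.instance Definition _ (f_proper : 1 \notin principal_ideal) :=
  isIdealr.Build R (proper_principal_ideal f_proper)
    (principal_ideal_closed f_proper).

Definition principal_quotient (f_proper : 1 \notin principal_ideal) :
    comNzRingType :=
  {ideal_quot (proper_principal_ideal f_proper)}.

End PrincipalQuotient.

Definition permanent (R : comNzRingType) n (A : 'M[R]_n) : R :=
  \sum_(s : 'S_n) \prod_(i < n) A i (s i).

Section Indeterminates.
Variables (k : fieldType) (m n : nat).
Implicit Type X : 'M[{mpoly k[m]}]_n.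

(* {mpoly k[m]} is k[X]: the entries of X are variables, and every variable   *)
(* occurs in X.                                                               *)
Definition indeterminate_mx X : Prop :=
  (forall i j, exists v : 'I_m, X i j = 'X_v) /\
  (forall v : 'I_m, exists i j, X i j = 'X_v).

Definition generic_mx X : Prop :=
  forall i j i' j', X i j = X i' j' -> i = i' /\ j = j'.

Definition symmetric_mx X : Prop :=
  (forall i j, X i j = X j i) /\
  (forall i j i' j' : 'I_n, (i <= j)%N -> (i' <= j')%N ->
    X i j = X i' j' -> i = i' /\ j = j').

(* Indices start at 0, so that z_(i+j-1) becomes z (i + j), 0 <= i+j < 2n-1.  *)
Definition hankel_mx X : Prop :=
  exists2 z : 'I_(2 * n - 1) -> {mpoly k[m]}, injective z &
    forall (i j : 'I_n) (l : 'I_(2 * n - 1)), l = (i + j)%N :> nat -> X i j = z l.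

Lemma permanent_proper X : (1 <= n)%N -> indeterminate_mx X ->
  1 \notin principal_ideal (permanent X).
Proof.
move=> n_gt0 [Xvar _]; apply/principal_idealP => -[g].
move/(congr1 (mmap idfun (fun=> 0 : k))).
have -> : mmap idfun (fun=> 0 : k) (g * permanent X) = 0.
  rewrite rmorphM /permanent rmorph_sum big1 ?mulr0 // => s _.
  rewrite rmorph_prod (bigD1 (Ordinal n_gt0)) //=.
  have [v ->] := Xvar (Ordinal n_gt0) (s (Ordinal n_gt0)).
  by rewrite mmapX mmap1U mul0r.
by rewrite rmorph1 => /eqP; rewrite oner_eq0.
Qed.

Definition permanent_ring X (n_ge1 : (1 <= n)%N) (hX : indeterminate_mx X) :
    comNzRingType :=
  principal_quotient (permanent_proper n_ge1 hX).

End Indeterminates.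

(* Main.v *)
Require Import Defs.
From mathcomp Require Import all_boot all_order all_fingroup all_algebra.
From mathcomp Require Import ring_quotient mpoly.
From mathcomp Require Import boolp classical_sets ring.

Set Implicit Arguments.
Unset Strict Implicit.
Unset Printing Implicit Defensive.

Import GRing.Theory.
Local Open Scope ring_scope.
Local Open Scope classical_set_scope.

(** The proof rests on a property that the three kinds of matrices share: two
    equal entries lie on the same antidiagonal. Write x for the entry in
    position (0, 0), A for the permanent of the trailing minor, and q = p^e.
    Then f = perm X is x A + B with A and B free of x.

    Every argument below has the form: multiply a membership modulo f by
    f^(q-1), so that it becomes a membership h r^q \in I^[q] of the polynomial
    ring S, with f \in I; then extract the coefficients on one class of
    monomials modulo q. The extraction [slice] is linear over q-th powers, up
    to the Frobenius of the coefficients. If it turns h into a unit times (the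
    Frobenius twist of) g, it yields g r \in I. This is
    [frobenius_power_split]. It holds over every field of characteristic p,
    because the solvability of a linear system does not change along the field
    embedding given by the Frobenius ([ideal_gen_descent]).

    Let c be a multiplier for r in the tight closure of an ideal. Since
    A x = - B modulo f, a power of A times c is congruent to a nonzero
    polynomial c0 free of x ([linear_eliminate], [linear_not_dvd]). The
    coefficient of x^(q-1) in A c0 f^(q-1) is A^q c0, and slicing it at the
    leading monomial of c0, for q large, leaves A times a unit. As r^p is in
    the tight closure of the p-th Frobenius power, this shows that A r^p lies
    in the p-th Frobenius power modulo f: A is a test element with exponent
    one ([linear_test]).

    It remains to find a monomial of A f^(p-1), with all exponents less than
    p, whose coefficient is nonzero; because of the degree, slicing there
    leaves this coefficient only ([linear_split]). If y and y' are the entries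
    in positions (0, 1) and (1, 0), and C is the permanent of the trailing
    minor of the trailing minor, then f = x A + y y' C + E, where E is free of
    x and has degree at most one in y and y'. So the coefficient of
    x^(p-2) y y' in A f^(p-1) is - A^(p-1) C: the same expression for the
    trailing minor. By induction ([permanent_coefficient]) the monomial
    x_00^(p-2) x_01 x_10 x_11^(p-2) x_12 x_21 ... x_nn^(p-1)
    has coefficient 1 or -1. Its exponents are less than p because p > 2 (in
    the symmetric and the Hankel case, x_01 x_10 is a square). *)

(** * Ideals and Frobenius powers modulo one element *)

Section Ideals.
Variable R : comNzRingType.
Implicit Types (S T : set R) (x y f : R).

Lemma ideal_gen_sum S (I : Type) (r : seq I) (P : pred I) (F : I -> R) :
  (forall i, P i -> ideal_gen S (F i)) -> ideal_gen S (\sum_(i <- r | P i) F i).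
Proof.
by move=> SF; apply: big_ind => //; [exact: ideal_gen0|exact: ideal_genD].
Qed.

Lemma ideal_gen_subset S T : S `<=` T -> ideal_gen S `<=` ideal_gen T.
Proof. by move=> ST; apply: ideal_gen_min => x /ST; apply: ideal_gen_sub. Qed.

Lemma ideal_gen_idem S x : ideal_gen S x ->
  ideal_gen (S `|` [set x]) = ideal_gen S.
Proof.
move=> Sx; apply/seteqP; split; last by apply: ideal_gen_subset => y; left.
by apply: ideal_gen_min => y [/ideal_gen_sub|->].
Qed.

(** Multiplication by f^(q-1) moves a membership modulo f into the ambient
    ring, since it turns the multiples of f into multiples of f^q. *)
Lemma frobenius_power_mulX S f q x : (0 < q)%N ->
  ideal_gen ([set m ^+ q | m in S] `|` [set f]) x ->
  frobenius_power (S `|` [set f]) q (f ^+ q.-1 * x).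
Proof.
move=> q_gt0 [s sS ->]; rewrite mulr_sumr big_seq.
apply: ideal_gen_sum => am /sS [[m Sm <-]|->]; rewrite mulrCA;
  apply: ideal_genM.
  by apply/ideal_genM/ideal_gen_sub; exists m => //; left.
by apply: ideal_gen_sub; exists f; [right|rewrite -exprSr prednK].
Qed.

Lemma image_expM S q q' :
  [set m ^+ (q * q') | m in S] = [set m ^+ q' | m in [set m ^+ q | m in S]].
Proof.
apply/seteqP; split=> [_ [m Sm <-]|_ [_ [m Sm <-] <-]].
  by exists (m ^+ q); rewrite ?exprM //; exists m.
by exists m; rewrite ?exprM.
Qed.

Lemma frobenius_power_self S p e x : p \in [pchar R] ->
  ideal_gen S x -> frobenius_power S (p ^ e) (x ^+ (p ^ e)).
Proof.
move=> pR Sx.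
rewrite (frobenius_power_ideal (T := S `|` [set x]) _ pR) ?ideal_gen_idem //.
by apply: ideal_gen_sub; exists x => //; right.
Qed.

End Ideals.

Section Quotient.
Variables (S Q : comNzRingType) (pi : {rmorphism S -> Q}) (f : S).
Hypothesis pi_surj : forall y, exists x, pi x = y.
Hypothesis pi_ker : forall x, pi x = 0 <-> exists g, x = g * f.

Lemma ideal_gen_quotient (T : set S) x :
  ideal_gen (pi @` T) (pi x) <-> ideal_gen (T `|` [set f]) x.
Proof.
split=> [[s sT eqx]|[s sT ->]]; last first.
  rewrite rmorph_sum big_seq; apply: ideal_gen_sum => am /sT Tam.
  rewrite rmorphM; apply: ideal_genM; case: Tam => [Tam|->].
    by apply: ideal_gen_sub; exists am.2.
  suff -> : pi f = 0 by exact: ideal_gen0.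
  by apply/pi_ker; exists 1; rewrite mul1r.
suff [y Ty eqy] : exists2 y, ideal_gen T y &
    \sum_(am <- s) am.1 * am.2 = pi y.
  move/eqP: eqx; rewrite eqy -subr_eq0 -rmorphB => /eqP/pi_ker [g].
  move/(canRL (subrK _)) ->; apply: ideal_genD.
    by apply/ideal_genM/ideal_gen_sub; right.
  by apply: ideal_gen_subset Ty => z; left.
elim: s sT {eqx} => [_|am s IHs sT].
  by exists 0; rewrite ?big_nil ?rmorph0 //; exact: ideal_gen0.
have [y Ty eqy] : exists2 y, ideal_gen T y & \sum_(am <- s) am.1 * am.2 = pi y.
  by apply: IHs => bm sbm; apply: sT; rewrite inE sbm orbT.
have [a am1] := pi_surj am.1.
have [b Tb am2] : (pi @` T) am.2 by apply: sT; rewrite mem_head.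
exists (a * b + y); first by apply/ideal_genD/Ty/ideal_genM/ideal_gen_sub.
by rewrite big_cons eqy rmorphD rmorphM am1 am2.
Qed.

Lemma frobenius_power_quotient (T : set S) q x :
  frobenius_power (pi @` T) q (pi x) <->
  ideal_gen ([set m ^+ q | m in T] `|` [set f]) x.
Proof.
rewrite -ideal_gen_quotient /frobenius_power.
suff -> : [set m ^+ q | m in pi @` T] = pi @` [set m ^+ q | m in T] by [].
apply/seteqP; split=> [_ [_ [m Tm <-] <-]|_ [_ [m Tm <-] <-]].
  by exists (m ^+ q); rewrite ?rmorphXn //; exists m.
by rewrite rmorphXn; exists (pi m) => //; exists m.
Qed.

End Quotient.

Lemma principal_quotientP (R : comNzRingType) (f : R)
    (f_proper : 1 \notin principal_ideal f) :
  exists pi : {rmorphism R -> principal_quotient f_proper},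
    (forall y, exists x, pi x = y) /\
    (forall x, pi x = 0 <-> exists g, x = g * f).
Proof.
pose I : {pred R} := proper_principal_ideal f_proper.
exists (\pi_{ideal_quot I})%qT; split=> [y|x].
  exists (generic_quotient.repr (y : {ideal_quot I})).
  exact: (generic_quotient.reprK (y : {ideal_quot I})).
rewrite (rwP (principal_idealP f x)).
have -> : (x \in principal_ideal f) = (x == 0 %[mod {ideal_quot I}])%qT.
  by rewrite -Quotient.idealrBE subr0.
rewrite -(rwP eqP).
by rewrite (rmorph0 (\pi_{ideal_quot I})%qT).
Qed.

(** * Ideal membership descends along field embeddings *)

Section Descent.
Variables (k k' : fieldType) (F : {rmorphism k -> k'}) (m : nat).
Implicit Types (g : {mpoly k[m]}) (I : set {mpoly k[m]}).

(** The coefficients of the combination solve a linear system whose matrix and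
    right-hand side come from k; such a system is solvable over k as soon as
    it is solvable over k', because ranks do not change under field maps. *)
Lemma span_descent g (ts : seq (k' * {mpoly k[m]})) :
  map_mpoly F g = \sum_(t <- ts) t.1 *: map_mpoly F t.2 ->
  exists y : 'I_(size ts) -> k,
    g = \sum_(i < size ts) y i *: (nth (0, 0) ts i).2.
Proof.
move=> eqg; pose h i := (nth (0, 0) ts i).2.
(* L lists every monomial that occurs in the equation. *)
pose L := flatten (msupp g :: [seq msupp t.2 | t <- ts]).
have hL mu i : mu \notin L -> (i < size ts)%N -> (h i)@_mu = 0.
  move=> muL ltit; apply/eqP; rewrite mcoeff_eq0; apply: contra muL => muh.
  rewrite /L /= mem_cat; apply/orP; right; apply/flatten_mapP.
  by exists (nth (0, 0) ts i); rewrite ?mem_nth.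
pose b := \row_(j < size L) g@_(nth 0%MM L j).
pose A := \matrix_(i < size ts, j < size L) (h i)@_(nth 0%MM L j).
have : (map_mx F b <= map_mx F A)%MS.
  apply/submxP; exists (\row_i (nth (0, 0) ts i).1); apply/rowP => j.
  rewrite !mxE -mcoeff_map_mpoly eqg (big_nth (0, 0)) big_mkord raddf_sum /=.
  by apply: eq_bigr => i _; rewrite !mxE mcoeffZ mcoeff_map_mpoly.
rewrite map_submx => /submxP[y eqb]; exists (fun i => y 0 i).
apply/mpolyP => mu; rewrite raddf_sum /=.
have [muL|muL] := boolP (mu \in L).
  have ltj : (index mu L < size L)%N by rewrite index_mem.
  move/rowP/(_ (Ordinal ltj)): eqb; rewrite !mxE /= nth_index // => ->.
  by apply: eq_bigr => i _; rewrite !mxE mcoeffZ /= nth_index.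
rewrite big1 => [|i _]; last by rewrite mcoeffZ (hL mu i) ?mulr0.
by apply/eqP; rewrite mcoeff_eq0; apply: contra muL; rewrite mem_cat => ->.
Qed.

Lemma ideal_gen_descent I g :
  ideal_gen [set map_mpoly F h | h in I] (map_mpoly F g) -> ideal_gen I g.
Proof.
case=> s sI eqg.
have [ts tsI /span_descent[y ->]] : exists2 ts : seq (k' * {mpoly k[m]}),
    (forall t, t \in ts -> ideal_gen I t.2) &
    map_mpoly F g = \sum_(t <- ts) t.1 *: map_mpoly F t.2.
  rewrite {g}eqg; elim: s sI => [_|am s IHs sI].
    by exists [::]; rewrite ?big_nil.
  have [|ts tsI eqts] := IHs; first by move=> bm sbm; apply: sI;
    rewrite inE sbm orbT.
  have [h Ih eqh] : [set map_mpoly F h | h in I] am.2 by apply/sI/mem_head.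
  exists ([seq (am.1@_mu, 'X_[mu] * h) | mu <- msupp am.1] ++ ts).
    move=> t; rewrite mem_cat => /orP[/mapP[mu _ ->]|/tsI //].
    by apply/ideal_genM/ideal_gen_sub.
  rewrite big_cons eqts big_cat big_map /= [in LHS](mpolyE am.1) mulr_suml -eqh.
  congr (_ + _); apply: eq_bigr => mu _.
  by rewrite rmorphM /= map_mpolyX scalerAl.
apply: ideal_gen_sum => i _; rewrite -mul_mpolyC; apply: ideal_genM.
exact/tsI/mem_nth.
Qed.

End Descent.

(** * Extracting a residue class of monomials *)

Section Slices.
Variables (R : comNzRingType) (m : nat).
Implicit Types (g h : {mpoly R[m]}) (a b mu : 'X_{1..m}).

Lemma mcoeff_mulX mu g b :
  ('X_[mu] * g)@_b = if (mu <= b)%MM then g@_(b - mu) else 0.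
Proof.
rewrite mulrC; case: ifP => mub;
  first by rewrite -{1}(submK mub) addmC mcoeffMX.
apply/eqP; rewrite mcoeff_eq0 (perm_mem (msuppMX _ _)).
by apply/mapP => -[mu' _ eqb]; rewrite eqb lem_addr in mub.
Qed.

(** This inverts the substitution of q-th powers for the variables, on the free
    summand generated by 'X_[a]. The bound on b only makes the sum finite. *)
Definition slice q a g : {mpoly R[m]} :=
  \sum_(b : 'X_{1..m < msize g}) g@_(a + b *+ q) *: 'X_[b].

Lemma mcoeff_slice q a g b : (0 < q)%N -> (slice q a g)@_b = g@_(a + b *+ q).
Proof.
move=> q_gt0; have [ltb|leb] := ltnP (mdeg b) (msize g).
  by rewrite (mcoeff_mpoly (fun b => g@_(a + b *+ q))).
rewrite raddf_sum /= big1 => [|c _]; last first.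
  rewrite mcoeffZ mcoeffX; case: eqP => [eqcb|]; last by rewrite mulr0.
  by have := bmdeg c; rewrite eqcb ltnNge leb.
apply/esym/eqP; rewrite mcoeff_eq0; apply: msize_mdeg_ge; rewrite mdegD mdegMn.
by apply: (leq_trans leb); rewrite (leq_trans (leq_pmulr _ q_gt0)) ?leq_addl.
Qed.

Lemma sliceD q a g h : (0 < q)%N ->
  slice q a (g + h) = slice q a g + slice q a h.
Proof.
by move=> q_gt0; apply/mpolyP => b; rewrite mcoeffD !mcoeff_slice ?mcoeffD.
Qed.

Lemma slice_mulXn q a mu h : (0 < q)%N -> (forall i, a i < q)%N ->
  slice q a ('X_[mu] ^+ q * h) = 'X_[mu] * slice q a h.
Proof.
move=> q_gt0 ltaq.
apply/mpolyP => b; rewrite mcoeff_slice // mpolyXn !mcoeff_mulX.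
have -> : (mu *+ q <= a + b *+ q)%MM = (mu <= b)%MM.
  apply/mnm_lepP/mnm_lepP => le_mu i; have := le_mu i.
    rewrite mnmDE !mulmnE => le_q; rewrite -ltnS -(ltn_pmul2r q_gt0).
    by rewrite (leq_ltn_trans le_q) // mulSn ltn_add2r.
  by rewrite mnmDE !mulmnE => le_i;
    rewrite (leq_trans _ (leq_addl _ _)) ?leq_mul2r ?le_i ?orbT.
case: ifP => // mub; rewrite mcoeff_slice //; congr (h@_ _).
apply/mnmP => i; rewrite !(mnmDE, mnmBE, mulmnE) mulnBl addnBA //.
by rewrite leq_mul2r (mnm_lepP mub) orbT.
Qed.

End Slices.

Section FrobeniusSplitting.
Variables (k : fieldType) (p : nat) (m : nat).
Hypothesis pchar_p : p \in [pchar k].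
Implicit Types (g h : {mpoly k[m]}) (I : set {mpoly k[m]}) (a : 'X_{1..m}).

Let p_gt0 e : (0 < p ^ e)%N.
Proof. by rewrite expn_gt0 prime_gt0 ?(pcharf_prime pchar_p). Qed.

Lemma frobenius_morphism e :
  exists F : {rmorphism k -> k}, F =1 (fun x => x ^+ (p ^ e)).
Proof.
elim: e => [|e [F eqF]]; first by exists idfun => x; rewrite expr1.
exists (pFrobenius_aut pchar_p \o F) => x /=.
by rewrite eqF pFrobenius_autE -exprM expnSr.
Qed.

(** A q-th power is a polynomial in the q-th powers of the variables, with the
    q-th powers of the coefficients of g; slicing is linear over these. *)
Lemma slice_mul_frobenius e (F : {rmorphism k -> k}) a g h :
    F =1 (fun x => x ^+ (p ^ e)) -> (forall i, a i < p ^ e)%N ->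
  slice (p ^ e) a (g ^+ (p ^ e) * h) = map_mpoly F g * slice (p ^ e) a h.
Proof.
move=> eqF lta.
have pq : [pchar {mpoly k[m]}].-nat (p ^ e)%N.
  have p_prime := pcharf_prime pchar_p.
  by rewrite pnatX (eq_pnat _ (pchar_lalg _)) pnatE ?pchar_p.
elim/mpolyind: g => [|c mu g _ _ IHg].
  rewrite expr0n gtn_eqF // (raddf0 (map_mpoly F)) !mul0r.
  by apply/mpolyP => b; rewrite mcoeff_slice // !mcoeff0.
rewrite exprDn_pchar // mulrDl sliceD // IHg [in RHS]raddfD /= mulrDl.
congr (_ + _); rewrite map_mpolyZ map_mpolyX eqF exprZn -!scalerAl
  -slice_mulXn //.
by apply/mpolyP => b; rewrite mcoeffZ !mcoeff_slice // mcoeffZ.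
Qed.

(** The slice of the membership lies in the ideal of the Frobenius twists of
    the elements of I; the descent along the Frobenius of k undoes the twist,
    whether or not k is perfect. *)
Lemma frobenius_power_split e I a g h (u : k) r :
    (forall F : {rmorphism k -> k}, F =1 (fun x => x ^+ (p ^ e)) ->
      slice (p ^ e) a h = u *: map_mpoly F g) ->
    u != 0 -> (forall i, a i < p ^ e)%N ->
  frobenius_power I (p ^ e) (h * r ^+ (p ^ e)) -> ideal_gen I (g * r).
Proof.
move=> slice_h u_neq0 lta [s sI eqs]; have [F eqF] := frobenius_morphism e.
apply: (ideal_gen_descent (F := F)).
have -> : map_mpoly F (g * r) = u^-1%:MP * slice (p ^ e) a (h * r ^+ (p ^ e)).
  rewrite [h * _]mulrC (slice_mul_frobenius _ _ eqF) // (slice_h F) //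
    -scalerAr mul_mpolyC.
  by rewrite scalerA mulVf // scale1r -rmorphM mulrC.
apply: ideal_genM; rewrite {}eqs; elim: s sI => [_|am s IHs sI].
  rewrite big_nil (_ : slice _ _ _ = 0); first exact: ideal_gen0.
  by apply/mpolyP => b; rewrite mcoeff_slice // !mcoeff0.
rewrite big_cons sliceD //; apply: ideal_genD; last first.
  by apply: IHs => bm sbm; apply: sI; rewrite inE sbm orbT.
have [mu Imu <-] : [set mu ^+ (p ^ e) | mu in I] am.2 by apply/sI/mem_head.
rewrite mulrC (slice_mul_frobenius _ _ eqF) // mulrC.
by apply/ideal_genM/ideal_gen_sub; exists mu.
Qed.

End FrobeniusSplitting.

(** * Degree in a set of variables *)

Section PartialDegree.
Variables (R : comNzRingType) (m : nat).
Implicit Types (g h : {mpoly R[m]}) (a b mu : 'X_{1..m}).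
Implicit Types (V : pred 'I_m) (d : nat).

Definition vdeg V mu := (\sum_(i | V i) mu i)%N.

Definition deg_le V d g := forall mu, g@_mu != 0 -> (vdeg V mu <= d)%N.

Lemma vdegD V a b : vdeg V (a + b) = (vdeg V a + vdeg V b)%N.
Proof. by rewrite /vdeg -big_split; apply: eq_bigr => i _; rewrite mnmDE. Qed.

Lemma vdegT mu : vdeg predT mu = mdeg mu.
Proof. by rewrite mdegE. Qed.

Lemma vdegU V v : vdeg V U_(v) = V v.
Proof.
rewrite /vdeg; case: (boolP (V v)) => Vv.
  by rewrite (bigD1 v) //= mnm1E eqxx big1 // => i /andP[_ /negPf];
    rewrite mnm1E eq_sym => ->.
by rewrite big1 // => i Vi; rewrite mnm1E; case: eqP => // eqvi;
  rewrite eqvi Vi in Vv.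
Qed.

Lemma vdeg1 v mu : vdeg (pred1 v) mu = mu v.
Proof. exact: big_pred1_eq. Qed.

Lemma deg_le_mcoeff V d g mu : deg_le V d g -> (d < vdeg V mu)%N -> g@_mu = 0.
Proof. by move=> degg; rewrite ltnNge; apply: contraNeq; apply: degg. Qed.

Lemma deg_leW V d d' g : (d <= d')%N -> deg_le V d g -> deg_le V d' g.
Proof. by move=> ledd' degg mu /degg/leq_trans; apply. Qed.

Lemma deg_le0 V d : deg_le V d 0.
Proof. by move=> mu; rewrite mcoeff0 eqxx. Qed.

Lemma deg_leC V d c : deg_le V d c%:MP.
Proof.
move=> mu; rewrite mcoeffC; have [->|_] := eqVneq mu 0%MM;
  last by rewrite mulr0 eqxx.
by rewrite /vdeg big1 // => i _; rewrite mnm0E.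
Qed.

Lemma deg_le1 V d : deg_le V d 1.
Proof. by rewrite -mpolyC1; apply: deg_leC. Qed.

Lemma deg_leD V d g h : deg_le V d g -> deg_le V d h -> deg_le V d (g + h).
Proof.
move=> degg degh mu; rewrite mcoeffD.
by have [->|/degg //] := eqVneq g@_mu 0; rewrite add0r => /degh.
Qed.

Lemma deg_leN V d g : deg_le V d g -> deg_le V d (- g).
Proof. by move=> degg mu; rewrite mcoeffN oppr_eq0; apply: degg. Qed.

Lemma deg_le_sum V d (I : Type) (r : seq I) (P : pred I)
    (G : I -> {mpoly R[m]}) :
  (forall i, P i -> deg_le V d (G i)) -> deg_le V d (\sum_(i <- r | P i) G i).
Proof.
by move=> degG; apply: big_ind => //; [exact: deg_le0|exact: deg_leD].
Qed.

Lemma deg_leMn V d g n : deg_le V d g -> deg_le V d (g *+ n).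
Proof.
move=> degg; elim: n => [|n IHn]; first exact: deg_le0.
by rewrite mulrS; exact: deg_leD.
Qed.

Lemma deg_leM V d e g h : deg_le V d g -> deg_le V e h ->
  deg_le V (d + e) (g * h).
Proof.
move=> degg degh mu; rewrite -mcoeff_msupp => /msuppM_le/allpairsP[[a b] /=].
by rewrite !mcoeff_msupp => -[/degg lea /degh leb ->]; rewrite vdegD leq_add.
Qed.

Lemma deg_leX V v : deg_le V (V v) 'X_v.
Proof.
by move=> mu; rewrite mcoeffX; have [<-|_] := eqVneq U_(v)%MM mu;
  rewrite ?vdegU ?eqxx.
Qed.

Lemma deg_leXn V d g n : deg_le V d g -> deg_le V (n * d) (g ^+ n).
Proof.
move=> degg; elim: n => [|n IHn]; first exact: deg_le1.
by rewrite exprS mulSn; apply: deg_leM.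
Qed.

Lemma deg_le_prod V (I : Type) (r : seq I) (d : I -> nat)
    (G : I -> {mpoly R[m]}) :
  (forall i, deg_le V (d i) (G i)) ->
  deg_le V (\sum_(i <- r) d i) (\prod_(i <- r) G i).
Proof.
move=> degG; apply: (big_ind2 (fun d g => deg_le V d g)) => //.
  exact: deg_le1.
by move=> d1 g1 d2 g2; apply: deg_leM.
Qed.

Lemma mpoly_ring_ind (P : {mpoly R[m]} -> Prop) :
    (forall c, P c%:MP) -> (forall v, P 'X_v) ->
    (forall g h, P g -> P h -> P (g + h)) ->
    (forall g h, P g -> P h -> P (g * h)) ->
  forall g, P g.
Proof.
move=> PC PX PD PM g; rewrite (mpolyE g); apply: big_ind => [|g1 g2|mu _].
- by rewrite -mpolyC0.
- exact: PD.
rewrite -mul_mpolyC; apply: (PM) => //; rewrite mpolyXE_id.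
have P1 : P 1 by rewrite -mpolyC1.
apply: big_ind => [|g1 g2|v _]; [exact: P1|exact: PM|].
by elim: (mu v) => // n Pn; rewrite exprS; apply: PM.
Qed.

End PartialDegree.

(** * Polynomials of degree one in a variable *)

Section LinearInVariable.
Variables (R : comNzRingType) (m : nat) (x : 'I_m) (A B : {mpoly R[m]}).
Hypotheses (degA : deg_le (pred1 x) 0 A) (degB : deg_le (pred1 x) 0 B).
Let f := 'X_x * A + B.

Let degxA : deg_le (pred1 x) 1 ('X_x * A).
Proof.
apply: (deg_leM (d := 1)) => //.
by have := @deg_leX R m (pred1 x) x; rewrite /= eqxx.
Qed.

Let degf : deg_le (pred1 x) 1 f.
Proof. by apply: deg_leD => //; apply: deg_leW degB. Qed.

Let degxAn n : deg_le (pred1 x) n (('X_x * A) ^+ n).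
Proof. by have := deg_leXn (n := n) degxA; rewrite muln1. Qed.

Lemma linear_pow1 n : exists2 G, f ^+ n.+1 = ('X_x * A) ^+ n.+1 + G &
  deg_le (pred1 x) n G.
Proof.
elim: n => [|n [G eqG degG]]; first by exists B.
exists (B * ('X_x * A) ^+ n.+1 + f * G).
  by rewrite [LHS]exprSr eqG /f [_ ^+ n.+2]exprSr; ring.
by apply: deg_leD; [apply: (deg_leM (d := 0))|apply: (deg_leM (d := 1))].
Qed.

Lemma linear_pow2 n : exists2 G,
  f ^+ n.+2 = ('X_x * A) ^+ n.+2 + (('X_x * A) ^+ n.+1 * B) *+ n.+2 + G &
  deg_le (pred1 x) n G.
Proof.
elim: n => [|n [G eqG degG]].
  exists (B ^+ 2); last by apply: (deg_leXn (n := 2) degB).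
  by rewrite expr1 sqrrD.
exists (B * B * ('X_x * A) ^+ n.+1 *+ n.+2 + f * G).
  have [N mulN] : exists N, forall g : {mpoly R[m]}, g *+ n.+2 = g * N.
    by exists n.+2%:R => g; rewrite mulr_natr.
  rewrite [LHS]exprSr eqG /f [_ ^+ n.+3]exprSr [_ ^+ n.+2]exprSr.
  rewrite [_ *+ n.+3]mulrSr !mulN.
  by move: (('X_x * A) ^+ n.+1) => P; ring.
apply: deg_leD; last by apply: (deg_leM (d := 1)).
apply/deg_leMn/(deg_leM (d := 0)) => //; exact: (deg_leM degB degB).
Qed.

(** Each occurrence of x is replaced by - B at the cost of one factor A; the
    congruences of this form are stable under sums and products. *)
Lemma linear_eliminate c : exists N c0 g,
  A ^+ N * c = c0 + g * f /\ deg_le (pred1 x) 0 c0.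
Proof.
elim/mpoly_ring_ind: c => [c|v|c d|c d].
- by exists 0%N, c%:MP, 0; rewrite mul0r addr0 mul1r; split=> //;
  apply: deg_leC.
- have [->|neq_vx] := eqVneq v x.
    exists 1%N, (- B), 1; rewrite mul1r /f addrC addrK expr1 mulrC; split=> //.
    exact: deg_leN.
  exists 0%N, 'X_v, 0; rewrite mul0r addr0 mul1r; split=> //.
  by have := @deg_leX R m (pred1 x) v; rewrite /= (negPf neq_vx).
- move=> [N [c0 [g [eqc degc]]]] [N' [d0 [h [eqd degd]]]].
  exists (N + N')%N, (A ^+ N' * c0 + A ^+ N * d0), (A ^+ N' * g + A ^+ N * h).
  have degAn n : deg_le (pred1 x) 0 (A ^+ n).
    by have := deg_leXn (n := n) degA; rewrite muln0.
  split; last by apply: deg_leD; apply: (deg_leM (degAn _)).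
  rewrite exprD mulrDr {1}[A ^+ N * _]mulrC -!mulrA eqc eqd.
  by move: (A ^+ N) (A ^+ N') f => P P' P''; ring.
move=> [N [c0 [g [eqc degc]]]] [N' [d0 [h [eqd degd]]]].
exists (N + N')%N, (c0 * d0), (c0 * h + g * d0 + g * f * h).
split; last exact: (deg_leM degc degd).
by rewrite exprD mulrACA eqc eqd; ring.
Qed.

End LinearInVariable.

(** All the other monomials in the class of a exceed the degree of g. *)
Lemma slice_const (R : comNzRingType) m q (a : 'X_{1..m}) (g : {mpoly R[m]}) :
  (0 < q)%N -> deg_le predT (mdeg a) g -> slice q a g = (g@_a)%:MP.
Proof.
move=> q_gt0 degg; apply/mpolyP => b; rewrite mcoeff_slice // mcoeffC.
have [->|b_neq0] := eqVneq b 0%MM.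
  by rewrite mulr1; congr (g@_ _); apply/mnmP => i;
    rewrite mnmDE mulmnE mnm0E addn0.
rewrite mulr0; apply: (deg_le_mcoeff degg).
rewrite vdegT mdegD mdegMn -[ltnLHS]addn0 ltn_add2l muln_gt0 q_gt0.
by rewrite lt0n mdeg_eq0 b_neq0.
Qed.

(** * F-regularity of a hypersurface that is linear in a variable *)

Section LinearHypersurface.
Variables (k : fieldType) (m : nat) (x : 'I_m) (A B : {mpoly k[m]}).
Hypotheses (degA : deg_le (pred1 x) 0 A) (degB : deg_le (pred1 x) 0 B).
Hypothesis A_neq0 : A != 0.
Let f := 'X_x * A + B.

(** As a univariate polynomial in x, a nonzero multiple of f has positive
    degree. *)
Lemma linear_not_dvd N g : A ^+ N <> g * f.
Proof.
(* Theta regards a polynomial as univariate in x. *)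
pose h i : {poly {mpoly k[m]}} := if i == x then 'X else ('X_i)%:P.
pose Theta : {rmorphism {mpoly k[m]} -> {poly {mpoly k[m]}}} :=
  mmap (polyC \o @mpolyC m k) h.
have ThetaC g0 : deg_le (pred1 x) 0 g0 -> Theta g0 = g0%:P.
  move=> deg0; rewrite (mpolyE g0) !rmorph_sum big_seq [RHS]big_seq.
  apply: eq_bigr => mu; rewrite mcoeff_msupp => /deg0;
    rewrite vdeg1 leqn0 => /eqP mux.
  rewrite -mul_mpolyC !rmorphM mpolyXE_id !rmorph_prod /= mmapC; congr (_ * _).
  apply: eq_bigr => i _; rewrite !rmorphXn /= mmapX mmap1U /h;
    case: eqP => [->|//].
  by rewrite mux !expr0.
move/(congr1 Theta); rewrite !rmorphM rmorphXn rmorphD rmorphM.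
rewrite (ThetaC _ degA) (ThetaC _ degB) /= mmapX mmap1U /h eqxx -polyC_exp => eqA.
have sz_f : size ('X * A%:P + B%:P) = 2.
  by rewrite mulrC size_MXaddC polyC_eq0 (negPf A_neq0) size_polyC A_neq0.
have := congr1 (fun P : {poly {mpoly k[m]}} => size P) eqA;
  rewrite /= size_polyC expf_neq0 //.
have [->|g_neq0] := eqVneq (Theta g) 0; first by rewrite mul0r size_poly0.
have f_neq0 : 'X * A%:P + B%:P != 0 by rewrite -size_poly_eq0 sz_f.
rewrite size_mul // sz_f addn2 => -[/esym/eqP].
by rewrite size_poly_eq0 (negPf g_neq0).
Qed.

Section Regularity.
Variables (p : nat) (M : 'X_{1..m}).
Hypotheses (pchar_p : p \in [pchar k]) (M_lt : forall i, (M i < p)%N).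
Hypothesis M_coeff : (A * f ^+ p.-1)@_M != 0.
Hypothesis M_deg : deg_le predT (mdeg M) (A * f ^+ p.-1).
Variables (Q : comNzRingType) (pi : {rmorphism {mpoly k[m]} -> Q}).
Hypothesis pi_surj : forall y, exists z, pi z = y.
Hypothesis pi_ker : forall z, pi z = 0 <-> exists g, z = g * f.

Let p_gt0 : (0 < p)%N.
Proof. exact/prime_gt0/(pcharf_prime pchar_p). Qed.

(** The splitting step: it uses that M is a monomial of A f^(p-1) outside the
    p-th Frobenius power of the ideal of the variables. *)
Lemma linear_split J r :
  ideal_gen ([set z ^+ p | z in J] `|` [set f]) (A * r ^+ p) ->
  ideal_gen (J `|` [set f]) r.
Proof.
move/(frobenius_power_mulX p_gt0); rewrite mulrA [_ * A]mulrC => Jr.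
rewrite -[r]mul1r.
apply: (frobenius_power_split (e := 1) (a := M) pchar_p _ M_coeff _ Jr) => //.
by move=> F eqF; rewrite slice_const // rmorph1 -mul_mpolyC mulr1.
Qed.

(** The part of f^(q-1) that has degree q-1 in x is x^(q-1) A^(q-1); with the
    factor A it contributes A^q c0, and A^q leaves the slice as A. *)
Lemma linear_test c0 e J r :
    deg_le (pred1 x) 0 c0 -> c0 != 0 -> (msize c0 < p ^ e)%N ->
  ideal_gen ([set z ^+ (p ^ e) | z in J] `|` [set f]) (c0 * r ^+ (p ^ e)) ->
  ideal_gen (J `|` [set f]) (A * r).
Proof.
move=> deg_c0 c0_neq0; set q := (p ^ e)%N => sz_c0.
have q_gt0 : (0 < q)%N by rewrite expn_gt0 p_gt0.
move/(frobenius_power_mulX q_gt0)/(ideal_genM A); rewrite !mulrA => Jr.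
(* Any monomial of maximal degree serves: slicing c0 there leaves a constant. *)
pose a := mlead c0; have a_supp : a \in msupp c0 by rewrite mlead_supp.
have lt_deg_q mu : mu \in msupp c0 -> (mdeg mu < q)%N.
  by move/msize_mdeg_lt/ltn_trans; apply.
have ax : a x = 0%N.
  by apply/eqP; rewrite -leqn0 -vdeg1; apply: deg_c0; rewrite -mcoeff_msupp.
set a' := (U_(x) *+ q.-1 + a)%MM.
have lt_a'_q i : (a' i < q)%N.
  rewrite mnmDE mulmnE mnm1E; have [<-|_] := eqVneq x i.
    by rewrite ax mul1n addn0 prednK.
  rewrite mul0n add0n; apply: leq_ltn_trans (lt_deg_q _ a_supp).
  by rewrite mdegE (bigD1 i) //= leq_addr.
apply: (frobenius_power_split (e := e) (a := a') pchar_p _ _ lt_a'_q Jr);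
    last first.
  by rewrite mcoeff_msupp in a_supp; exact: a_supp.
move=> F eqF; rewrite -/q.
have [n eqq] : exists n, q = n.+2.
  have q_gt1 : (1 < q)%N.
    by rewrite (leq_ltn_trans _ sz_c0) // lt0n msize_poly_eq0.
  by exists q.-2; rewrite -subn2 -addn2 subnK.
have [G -> degG] : exists2 G,
    f ^+ q.-1 = ('X_x * A) ^+ q.-1 + G & deg_le (pred1 x) q.-2 G.
  by rewrite eqq; apply: linear_pow1.
have -> : A * (('X_x * A) ^+ q.-1 + G) * c0 =
    A ^+ q * ('X_[U_(x) *+ q.-1] * c0) + G * (A * c0).
  rewrite -mpolyXn exprMn eqq exprS /=.
  by move: ('X_x ^+ _) (A ^+ _) => P P'; ring.
rewrite sliceD // (slice_mul_frobenius pchar_p _ _ eqF) //.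
have -> : slice q a' (G * (A * c0)) = 0.
  apply/mpolyP => b; rewrite mcoeff_slice // mcoeff0.
  apply: (deg_le_mcoeff (deg_leM degG (deg_leM degA deg_c0))).
  rewrite !addn0 vdeg1 !mnmDE !mulmnE mnm1E eqxx mul1n eqq /=.
  by rewrite -addnA ltn_addr.
rewrite addr0 slice_const //.
  by rewrite mcoeff_mulX lem_addr /a' addmC addmK mulrC mul_mpolyC.
rewrite mdegD; apply: deg_leM => mu; rewrite vdegT.
  by rewrite mcoeffX; have [->|_] := eqVneq _ mu; rewrite ?eqxx.
by rewrite -mcoeff_msupp => /msize_mdeg_lt; rewrite -mlead_deg.
Qed.

Theorem F_regular_linear : F_regular Q p.
Proof.
move=> J; apply/seteqP; split=> [rbar|rbar Jr]; last first.
  have pQ : p \in [pchar Q].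
    by rewrite (rmorph_pchar pi) // pchar_lalg.
  exists 1; first exact: lreg1.
  by exists 0%N => e _; rewrite mul1r; apply: frobenius_power_self.
case=> cbar c_reg [e0 tight_r].
have [c eqc] := pi_surj cbar; have [r eqr] := pi_surj rbar.
pose T := [set z | J (pi z)].
have eqJ : J = pi @` T.
  apply/seteqP; split=> [y Jy|_ [z Tz <-]] //.
  by have [z eqz] := pi_surj y; exists z => //; rewrite /T /= eqz.
have [N [c0 [g [eqc0 deg_c0]]]] := linear_eliminate degA degB c.
have c0_neq0 : c0 != 0.
  apply/eqP => c0_eq0; move/(congr1 pi): eqc0; rewrite c0_eq0 add0r.
  have -> : pi (g * f) = 0 by apply/pi_ker; exists g.
  rewrite rmorphM eqc mulrC -[0](mulr0 cbar) => /c_reg /pi_ker[h].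
  exact: linear_not_dvd.
rewrite -eqr eqJ ideal_gen_quotient //; apply: linear_split.
apply: (linear_test (e := (e0 + msize c0)%N) deg_c0 c0_neq0).
  rewrite (leq_trans _ (leq_pexp2l p_gt0 (leq_addl _ _))) // ltn_expl //.
  exact/prime_gt1/(pcharf_prime pchar_p).
(* The multiplier c is applied to r^p, hence the exponent e.+1. *)
set e := (e0 + _)%N; rewrite -image_expM -exprM -expnS.
have : ideal_gen ([set z ^+ (p ^ e.+1) | z in T] `|` [set f])
    (c * r ^+ (p ^ e.+1)).
  rewrite -frobenius_power_quotient // -eqJ rmorphM rmorphXn eqc eqr.
  by apply: tight_r; rewrite leqW // leq_addr.
move/(ideal_genM (A ^+ N)); rewrite mulrA eqc0 => memJ.
have -> : c0 * r ^+ (p ^ e.+1) =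
    (c0 + g * f) * r ^+ (p ^ e.+1) + (- g * r ^+ (p ^ e.+1)) * f.
  by rewrite mulrDl !mulNr [g * _ * f]mulrAC addrK.
by apply: ideal_genD => //; apply/ideal_genM/ideal_gen_sub; right.
Qed.

End Regularity.
End LinearHypersurface.

(** * Permanents of matrices of variables *)

Section Permanent.
Variable R : comNzRingType.

Lemma expand_permanent_row n (A : 'M[R]_n.+1) :
  permanent A = \sum_j A ord0 j * permanent (row' ord0 (col' j A)).
Proof.
rewrite /permanent (partition_big (fun s : 'S_n.+1 => s ord0) predT) //=.
apply: eq_bigr => j _; rewrite mulr_sumr.
rewrite (eq_bigl (fun s => s \in imset (lift_perm ord0 j) (mem 'S_n)));
  last first.
  move=> s; apply/eqP/imsetP => [s0|[t _ ->]]; last by rewrite lift_perm_id.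
  have [t tE] : exists t : 'I_n -> 'I_n,
      forall i, s (lift ord0 i) = lift j (t i).
    exists (fun i => odflt i (unlift j (s (lift ord0 i)))) => i.
    case: unliftP => //= /eqP; rewrite -s0 (inj_eq perm_inj).
    by rewrite eq_sym (negPf (neq_lift _ _)).
  have t_inj : injective t.
    move=> i i' eqt; apply/(@lift_inj _ ord0)/(@perm_inj _ s).
    by rewrite !tE eqt.
  exists (perm t_inj) => //; apply/permP => i.
  by case: (unliftP ord0 i) => [i'|] ->;
    rewrite ?lift_perm_id // lift_perm_lift permE tE.
rewrite big_imset /=; last first.
  move=> s t _ _ /permP eqst; apply/permP => i; apply: (@lift_inj _ j).
  by rewrite -!(lift_perm_lift ord0) eqst.
apply: eq_bigr => t _; rewrite big_ord_recl lift_perm_id; congr (_ * _).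
by apply: eq_bigr => i _; rewrite lift_perm_lift !mxE.
Qed.

End Permanent.

Lemma deg_le_permanent (R : comNzRingType) m n (V : pred 'I_m) (d : 'I_n -> nat)
    (A : 'M[{mpoly R[m]}]_n) :
  (forall i j, deg_le V (d i) (A i j)) -> deg_le V (\sum_i d i) (permanent A).
Proof.
by move=> degA; apply: deg_le_sum => s _; apply: deg_le_prod => i.
Qed.

Section VariableMatrix.
Variables (k : fieldType) (m : nat).

Definition varmx n (v : 'I_n -> 'I_n -> 'I_m) : 'M[{mpoly k[m]}]_n :=
  \matrix_(i, j) 'X_(v i j).

(** The common feature of generic, symmetric and Hankel matrices. It passes to
    trailing minors, so that one induction treats the three kinds. *)
Definition antidiagonal_repeats n (v : 'I_n -> 'I_n -> 'I_m) :=
  forall i j i' j', v i j = v i' j' -> (i + j = i' + j')%N.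

Definition minor n (v : 'I_n.+1 -> 'I_n.+1 -> 'I_m) i j :=
  v (lift ord0 i) (lift ord0 j).

Lemma minor_antidiagonal_repeats n (v : 'I_n.+1 -> 'I_n.+1 -> 'I_m) :
  antidiagonal_repeats v -> antidiagonal_repeats (minor v).
Proof.
move=> adv i j i' j' /adv; rewrite !lift0 !addSn !addnS.
by case.
Qed.

Lemma varmx_minor n (v : 'I_n.+1 -> 'I_n.+1 -> 'I_m) :
  row' ord0 (col' ord0 (varmx v)) = varmx (minor v).
Proof. by apply/matrixP => i j; rewrite !mxE. Qed.

Section Degrees.
Variables (n : nat) (v : 'I_n -> 'I_n -> 'I_m) (V : pred 'I_m) (s : nat).
Hypothesis V_antidiagonal : forall i j, V (v i j) -> (i + j)%N = s.

Lemma deg_le_entry (i j : 'I_n) : deg_le V (i + j == s)%N (varmx v i j).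
Proof.
rewrite mxE; apply: (deg_leW _ (@deg_leX k m V (v i j))).
by case: (boolP (V _)) => // /V_antidiagonal ->; rewrite eqxx.
Qed.

Lemma deg_le_entry0 (i j : 'I_n) : (s < i + j)%N -> deg_le V 0 (varmx v i j).
Proof. by move=> lts; have := @deg_le_entry i j; rewrite gtn_eqF. Qed.

Lemma deg_le_entry1 (i j : 'I_n) : deg_le V 1 (varmx v i j).
Proof. by apply: (deg_leW _ (@deg_le_entry i j)); case: eqP. Qed.

End Degrees.

Lemma deg_le_permanent0 n (V : pred 'I_m) (Z : 'M[{mpoly k[m]}]_n) :
  (forall i j, deg_le V 0 (Z i j)) -> deg_le V 0 (permanent Z).
Proof. by move=> degZ; have := deg_le_permanent degZ; rewrite big1. Qed.

Lemma deg_permanent_minor n (v : 'I_n.+1 -> 'I_n.+1 -> 'I_m) (V : pred 'I_m) :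
  (forall i j, V (v i j) -> (i + j < 2)%N) ->
  deg_le V 0 (permanent (varmx (minor v))).
Proof.
move=> V_lt2; apply: deg_le_permanent0 => i j; rewrite mxE.
apply: (deg_leW _ (@deg_leX k m V (minor v i j))).
by case: (boolP (V _)) => // /V_lt2; rewrite !lift0 addSn addnS.
Qed.

Section Expansion.
Variables (n : nat) (v : 'I_n.+1 -> 'I_n.+1 -> 'I_m).
Hypothesis adv : antidiagonal_repeats v.
Let x := v ord0 ord0.

Let x_antidiagonal i j : pred1 x (v i j) -> (i + j)%N = 0%N.
Proof. by move=> /eqP/adv. Qed.

Lemma permanent_linear : exists2 B,
  permanent (varmx v) = 'X_x * permanent (varmx (minor v)) + B &
  deg_le (pred1 x) 0 B.
Proof.
rewrite expand_permanent_row big_ord_recl varmx_minor {1}mxE.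
eexists; first by [].
apply: deg_le_sum => j _; apply: (deg_leM (d := 0)).
  exact: (deg_le_entry0 x_antidiagonal).
apply: deg_le_permanent0 => i l; rewrite !mxE.
set a := lift ord0 i; set b := lift _ l.
by have := @deg_le_entry0 _ _ _ _ x_antidiagonal a b isT; rewrite mxE.
Qed.

End Expansion.

(** The term y y' C comes from the permutations that exchange 0 and 1. Every
    other permutation that moves 0 uses at most one of the positions (0, 1)
    and (1, 0), and no other position carries y or y'. *)
Lemma permanent_linear2 n (v : 'I_n.+2 -> 'I_n.+2 -> 'I_m)
    (one := lift ord0 ord0 : 'I_n.+2)
    (x := v ord0 ord0) (y := v ord0 one) (y' := v one ord0) :
  antidiagonal_repeats v ->
  exists E, [/\ permanent (varmx v) = 'X_x * permanent (varmx (minor v)) +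
      ('X_y * 'X_y' * permanent (varmx (minor (minor v))) + E),
    deg_le (pred1 x) 0 E & deg_le (pred2 y y') 1 E].
Proof.
move=> adv.
have x_ad i j : pred1 x (v i j) -> (i + j)%N = 0%N by move=> /eqP/adv.
have y_ad i j : pred2 y y' (v i j) -> (i + j)%N = 1%N by case/orP=> /eqP/adv.
set X := varmx v; pose Y := row' ord0 (col' one X).
pose E1 := \sum_(j < n) Y ord0 (lift ord0 j) *
  permanent (row' ord0 (col' (lift ord0 j) Y)).
pose E2 := \sum_(j < n) X ord0 (lift ord0 (lift ord0 j)) *
  permanent (row' ord0 (col' (lift ord0 (lift ord0 j)) X)).
exists ('X_y * E1 + E2); split.
- rewrite expand_permanent_row big_ord_recl varmx_minor {1}mxE; congr (_ + _).
  rewrite big_ord_recl addrA; congr (_ + _).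
  rewrite -/one -/Y (expand_permanent_row Y) big_ord_recl -/E1.
  rewrite mulrDr mulrA !mxE.
  have -> : lift one ord0 = ord0 by exact: val_inj.
  suff -> : row' ord0 (col' ord0 Y) = varmx (minor (minor v)) by [].
  by apply/matrixP => i j; rewrite !mxE /minor; congr ('X_(v _ _));
    exact: val_inj.
- have X0 (i j : 'I_n.+2) : (0 < i + j)%N -> deg_le (pred1 x) 0 (X i j).
    exact: deg_le_entry0.
  have P0 j : deg_le (pred1 x) 0 (permanent (row' ord0 (col' j X))).
    by apply: deg_le_permanent0 => i l; rewrite 2!mxE; apply: X0.
  apply: deg_leD; last first.
    by apply: deg_le_sum => j _; apply: (deg_leM (d := 0)); [exact: X0|exact: P0].
  have -> : 'X_y = X ord0 one by rewrite mxE.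
  apply: (deg_leM (d := 0)); first exact: X0.
  apply: deg_le_sum => j _; apply: (deg_leM (d := 0));
    first by rewrite 2!mxE; apply: X0.
  by apply: deg_le_permanent0 => i l; rewrite 4!mxE; apply: X0.
have X0 (i j : 'I_n.+2) : (1 < i + j)%N -> deg_le (pred2 y y') 0 (X i j).
  exact: deg_le_entry0.
have X1 (i j : 'I_n.+2) : deg_le (pred2 y y') 1 (X i j).
  exact: (deg_le_entry1 y_ad).
apply: deg_leD.
  have -> : 'X_y = X ord0 one by rewrite mxE.
  apply: (deg_leM (d := 1) (e := 0)); first exact: X1.
  apply: deg_le_sum => j _; apply: (deg_leM (d := 0));
    first by rewrite 2!mxE; apply: X0.
  by apply: deg_le_permanent0 => i l; rewrite 4!mxE; apply: X0.
apply: deg_le_sum => j _; apply: (deg_leM (d := 0)); first exact: X0.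
suff : deg_le (pred2 y y') (\sum_(i < n.+1) (i == ord0))
    (permanent (row' ord0 (col' (lift ord0 (lift ord0 j)) X))).
  by rewrite big_ord_recl big1.
apply: deg_le_permanent => i l; rewrite 2!mxE.
have [_|i_neq0] := eqVneq i ord0; first exact: X1.
by apply: X0; case: i i_neq0 => -[].
Qed.

End VariableMatrix.

Lemma permanent_mx0 (R : comNzRingType) (A : 'M[R]_0) : permanent A = 1.
Proof.
rewrite /permanent (eq_bigr (fun=> 1)) => [|s _]; last by rewrite big_ord0.
by rewrite sumr_const card_Sn.
Qed.

(** * A monomial of A f^(p-1) with small exponents *)

Section Coefficient.
Variables (k : fieldType) (m t : nat).
Hypothesis t_neq0 : t.+2%:R != 0 :> k.

(** Here t.+3 stands for p. The induction also records that M only involves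
    entries of the matrix: this keeps the monomial found for the trailing minor
    free of x, y and y'. *)
Lemma permanent_coefficient n (v : 'I_n.+1 -> 'I_n.+1 -> 'I_m) :
  antidiagonal_repeats v ->
  exists M : 'X_{1..m},
    [/\ forall i, (M i < t.+3)%N, forall i, M i != 0%N -> exists a b, i = v a b,
        mdeg M = (n * t.+3 + t.+2)%N &
        (permanent (varmx k (minor v)) *
          permanent (varmx k v) ^+ t.+2)@_M != 0].
Proof.
elim: n v => [|n IHn] v adv.
  pose x := v ord0 ord0; exists (U_(x) *+ t.+2)%MM; split.
  - by move=> i; rewrite mulmnE mnm1E; case: (_ == _); rewrite ?mul1n.
  - move=> i; rewrite mulmnE mnm1E; have [<- _|_] := eqVneq x i.
      by exists ord0, ord0.
    by rewrite mul0n.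
  - by rewrite mdegMn mdeg1 mul1n.
  rewrite permanent_mx0 mul1r expand_permanent_row big_ord_recl big_ord0 addr0.
  by rewrite permanent_mx0 mulr1 mxE mpolyXn mcoeffX eqxx oner_neq0.
have [E [eqf degE degE2]] := permanent_linear2 k adv.
set x := v ord0 ord0 in eqf degE; set y := v ord0 _ in eqf degE2.
set y' := v _ ord0 in eqf degE2.
set A := permanent (varmx k (minor v)) in eqf *.
set C := permanent (varmx k (minor (minor v))) in eqf *.
have [M' [M'_lt M'_supp M'_deg M'_coeff]] :=
  IHn (minor v) (minor_antidiagonal_repeats adv).
have M'0 (i j : 'I_n.+2) : (i + j < 2)%N -> M' (v i j) = 0%N.
  move=> lt2; apply: contraTeq lt2 => /M'_supp[a [b /adv ->]].
  by rewrite !lift0 addSn addnS.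
have M'x : M' x = 0%N by exact: M'0.
have neq_xy : x != y by apply/eqP => /adv.
have neq_xy' : x != y' by apply/eqP => /adv.
have degA : deg_le (pred1 x) 0 A.
  by apply: deg_permanent_minor => i j /eqP/adv ->.
have degA2 : deg_le (pred2 y y') 0 A.
  by apply: deg_permanent_minor => i j /orP[] /eqP/adv ->.
have degC : deg_le (pred1 x) 0 C.
  by apply: deg_permanent_minor => i j /eqP/adv; rewrite !lift0.
(* The exponent of x is one less than p-1, so that exactly one factor of
   f^(p-1) contributes its part free of x. *)
pose W := (U_(x) *+ t.+1 + (U_(y) + U_(y')))%MM.
have T_x : (W + M')%MM x = t.+1.
  by rewrite !mnmDE mulmnE !mnm1E M'x eqxx ![_ == x]eq_sym (negPf neq_xy)
    (negPf neq_xy') mul1n !addn0.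
exists (W + M')%MM; split.
- move=> i; rewrite mnmDE; have [M'i|/M'_supp[a [b eqi]]] := eqVneq (M' i) 0%N.
    rewrite M'i addn0 !mnmDE mulmnE !mnm1E; have [<-|_] := eqVneq x i.
      by rewrite ![_ == x]eq_sym (negPf neq_xy) (negPf neq_xy') mul1n !addn0.
    by rewrite mul0n add0n; case: (y == i); case: (y' == i).
  rewrite !mnmDE mulmnE !mnm1E.
  have neq_i (c d : 'I_n.+2) : (c + d < 2)%N -> (v c d == i) = false.
    move=> lt2; apply: contraTF lt2 => /eqP; rewrite eqi => /adv ->.
    by rewrite !lift0 addSn addnS.
  by rewrite /x /y /y' !neq_i // mul0n !add0n M'_lt.
- move=> i; rewrite mnmDE.
  have [M'i|/M'_supp[a [b ->]] _] := eqVneq (M' i) 0%N; last first.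
    by exists (lift ord0 a), (lift ord0 b).
  rewrite M'i addn0 !mnmDE mulmnE !mnm1E.
  have [<- _|_] := eqVneq x i; first by eexists; eexists.
  have [<- _|_] := eqVneq y i; first by eexists; eexists.
  have [<- _|_] := eqVneq y' i; first by eexists; eexists.
  by rewrite mul0n.
- by rewrite !mdegD mdegMn !mdeg1 M'_deg mul1n addn2 addnA mulSn.
have degB : deg_le (pred1 x) 0 ('X_y * 'X_y' * C + E).
  apply: deg_leD => //; apply: (deg_leM (d := 0)) => //.
  have degX w : x != w -> deg_le (pred1 x) 0 ('X_w : {mpoly k[m]}).
    by move=> /negPf neq; have := @deg_leX k m (pred1 x) w;
      rewrite /= eq_sym neq.
  by apply: (deg_leM (d := 0)); apply: degX.
have [G eqG degG] := linear_pow2 degA degB t.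
rewrite eqf eqG 2!mulrDr 2!mcoeffD.
have -> : A * ('X_x * A) ^+ t.+2 = 'X_[U_(x) *+ t.+2] * (A * A ^+ t.+2).
  by rewrite exprMn mpolyXn mulrCA.
rewrite mcoeff_mulX ifN; last first.
  by apply/negP => /mnm_lepP/(_ x); rewrite T_x mulmnE mnm1E eqxx mul1n ltnn.
rewrite add0r (deg_le_mcoeff (deg_leM degA degG)) ?vdeg1 ?T_x // addr0.
rewrite mulrnAr mcoeffMn -mulr_natl mulf_neq0 //.
have -> : A * (('X_x * A) ^+ t.+1 * ('X_y * 'X_y' * C + E)) =
    'X_[W] * (C * A ^+ t.+2) + 'X_x ^+ t.+1 * A ^+ t.+2 * E.
  rewrite exprMn 2!mpolyXD -mpolyXn [A ^+ t.+2]exprS.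
  by move: ('X_x ^+ _) (A ^+ t.+1) => P P'; ring.
rewrite mcoeffD mcoeff_mulX lem_addr [(W + M')%MM]addmC addmK.
(* The monomial has degree two in y and y', while E has degree at most one. *)
rewrite (deg_le_mcoeff (d := 1) (V := pred2 y y') _ (g := _ * E)) ?addr0 //.
  apply: (deg_leM (d := 0)) => //; apply: (deg_leM (d := 0)); last first.
    by have := deg_leXn (n := t.+2) degA2; rewrite muln0.
  have := deg_leXn (n := t.+1) (@deg_leX k m (pred2 y y') x).
  by rewrite /= (negPf neq_xy) (negPf neq_xy') muln0.
by rewrite /W !vdegD !vdegU /= !eqxx orbT addnA leq_addl.
Qed.

End Coefficient.

(** * Generic, symmetric and Hankel matrices *)

Lemma antidiagonal_repeats_of_type (k : fieldType) m n (X : 'M[{mpoly k[m]}]_n)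
    (v : 'I_n -> 'I_n -> 'I_m) : (forall i j, X i j = 'X_(v i j)) ->
  generic_mx X \/ symmetric_mx X \/ hankel_mx X -> antidiagonal_repeats v.
Proof.
move=> vE typeX i j i' j' eqv; have {eqv} : X i j = X i' j' by rewrite !vE eqv.
case: typeX => [genX /genX[-> ->] //|[[symX injX]|[z z_inj hankX]]].
  have sym_le a b : exists a' b' : 'I_n,
      [/\ (a' <= b')%N, X a b = X a' b' & (a + b = a' + b')%N].
    by have [leab|/ltnW leba] := leqP a b; [exists a, b|exists b, a;
      rewrite addnC].
  have [a [b [leab -> ->]]] := sym_le i j;
    have [a' [b' [leab' -> ->]]] := sym_le i' j'.
  by move/injX => [] // -> ->.
have lt_sum (a b : 'I_n) : (a + b < 2 * n - 1)%N.
  case: n a b {X v vE i j i' j' z z_inj hankX} => [|n] [a lta] [b ltb] //=.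
  by rewrite mul2n doubleS subn1 /= ltnS -addnn leq_add.
rewrite (hankX _ _ (Ordinal (lt_sum i j))) //.
rewrite (hankX _ _ (Ordinal (lt_sum i' j'))) //.
by move=> /z_inj/(congr1 val).
Qed.

Theorem theorem1p1 (k : fieldType) (p : nat) (hp : p \in [pchar k])
    (p_gt2 : (2 < p)%N) (n : nat) (n_ge1 : (1 <= n)%N)
    (m : nat) (X : 'M[{mpoly k[m]}]_n) (hX : indeterminate_mx X) :
  generic_mx X \/ symmetric_mx X \/ hankel_mx X ->
  F_regular (permanent_ring n_ge1 hX) p.
Proof.
move=> typeX.
have [v vE] : exists v : 'I_n -> 'I_n -> 'I_m, forall i j, X i j = 'X_(v i j).
  have /choice[v vE] := fun ij : 'I_n * 'I_n => hX.1 ij.1 ij.2.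
  by exists (fun i j => v (i, j)) => i j; rewrite (vE (i, j)).
have adv := antidiagonal_repeats_of_type vE typeX.
have eqX : X = varmx k v by apply/matrixP => i j; rewrite mxE vE.
have [pi [pi_surj pi_ker]] := principal_quotientP (permanent_proper n_ge1 hX).
rewrite /permanent_ring;
  move: (principal_quotient _) pi pi_surj pi_ker => Q pi pi_surj.
rewrite {X hX typeX vE}eqX; case: n n_ge1 v adv => // n _ v adv.
have [t eqp] : exists t, p = t.+3 by exists (p - 3)%N; rewrite -addn3 subnK.
have t_neq0 : t.+2%:R != 0 :> k.
  by rewrite -(dvdn_pcharf hp) gtnNdvd // eqp.
have [M [M_lt _ M_deg M_coeff]] := permanent_coefficient t_neq0 adv.
have [B eqf degB] := permanent_linear k adv.
set x := v ord0 ord0 in eqf degB;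
  set A := permanent (varmx k (minor v)) in eqf M_coeff.
have degA : deg_le (pred1 x) 0 A.
  by apply: deg_permanent_minor => i j /eqP/adv ->.
have A_neq0 : A != 0 by apply: contraNneq M_coeff => ->; rewrite mul0r mcoeff0.
rewrite eqf in M_coeff *.
have M_top : deg_le predT (mdeg M) (A * ('X_x * A + B) ^+ p.-1).
  have deg_permanent l (w : 'I_l -> 'I_l -> 'I_m) :
      deg_le predT l (permanent (varmx k w)).
    have sum1 : (\sum_(i < l) 1)%N = l by rewrite sum1_card card_ord.
    by rewrite -{1}sum1; apply: deg_le_permanent => i j; rewrite mxE;
      apply: (@deg_leX k m predT).
  rewrite -eqf M_deg eqp /=.
  have degXn := deg_leXn (n := t.+2) (deg_permanent _ v).
  apply: (deg_leW _ (deg_leM (deg_permanent _ _) degXn)).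
  rewrite mulnS [(n * _)%N]mulnC [(t.+3 * n)%N]mulSn.
  by rewrite -addnA [(_ * n + _)%N]addnC.
apply: (F_regular_linear degA degB A_neq0 hp (M := M)) pi_surj => //.
- by rewrite eqp.
- by rewrite eqp.
Qed.
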